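(* Let $X$ be a Banach space, let $1\le p\le 2$, and suppose that $X$ has Rademacher type $p$. Then for every $n\ge 1$ and every function $f:\Omega_n\to X$, $$ \|f-\mathbb E f\|_{L^p(\Omega_n,X)} \le p\,T_p^R(X) \left( \sum_{j=1}^{n} \|D_jf\|_{L^p(\Omega_n,X)}^p \right)^{1/p}. $$
   Context: $\Omega_n=\{-1,1\}^n$ is the $n$-dimensional Hamming cube with the uniform probability measure. For $f:\Omega_n\to X$, where $(X,\|\cdot\|_X)$ is a Banach space, write $\mathbb E f=2^{-n}\sum_{\varepsilon\in\Omega_n}f(\varepsilon)\in X$ and, for $1\le p<\infty$, $\|f\|_{L^p(\Omega_n,X)}=\left(2^{-n}\sum_{\varepsilon\in\Omega_n}\|f(\varepsilon)\|_X^p\right)^{1/p}$. For $\varepsilon\in\Omega_n$ and $j\in\{1,\ldots,n\}$, $\varepsilon^{(j)}$ denotes $\varepsilon$ with its $j$-th coordinate flipped (multiplied by $-1$), and $D_jf(\varepsilon)=\frac{f(\varepsilon)-f(\varepsilon^{(j)})}{2}$. Rademacher type: for $p\in[1,2]$, the Banach space $X$ has Rademacher type $p$ if there exists $C\in(0,\infty)$ such that for every $n\ge1$, every $x_1,\ldots,x_n\in X$, and independent Rademacher variables $\varepsilon_1,\ldots,\varepsilon_n$ (uniform on $\{-1,1\}$), $$\mathbb E_\varepsilon\Big\|\sum_{j=1}^n\varepsilon_jx_j\Big\|_X^p\le C^p\sum_{j=1}^n\|x_j\|_X^p.$$ $T_p^R(X)$ denotes the smallest possible (i.e. the infimum of all)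 such constants $C$. *)

(* Defs.v *)
From HB Require Import structures.
From mathcomp Require Import all_boot all_order all_algebra.
From mathcomp Require Import all_classical all_reals all_analysis.

Set Implicit Arguments.
Unset Strict Implicit.
Unset Printing Implicit Defensive.

Import Order.TTheory GRing.Theory Num.Theory.
Import numFieldNormedType.Exports.

Local Open Scope classical_set_scope.
Local Open Scope ring_scope.

(* The cube {-1,1}^n is encoded by boolean vectors: the Boolean [b] stands for
   the sign [(-1) ^+ b], so [false] is 1 and [true] is -1. *)
Definition cube (n : nat) := {ffun 'I_n -> bool}.

Definition cube_sign (R : realType) (n : nat) (eps : cube n) (j : 'I_n) : R :=
  (-1) ^+ eps j.

Definition cube_flip (n : nat) (j : 'I_n) (eps : cube n) : cube n :=
  [ffun i => if i == j then ~~ eps i else eps i].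

Definition cube_mean (R : realType) (X : normedModType R) (n : nat)
    (f : cube n -> X) : X :=
  (2 ^+ n)^-1 *: \sum_(eps : cube n) f eps.

Definition cube_Lp (R : realType) (X : normedModType R) (n : nat) (p : R)
    (f : cube n -> X) : R :=
  ((2 ^+ n)^-1 * \sum_(eps : cube n) `|f eps| `^ p) `^ p^-1.

Definition cube_D (R : realType) (X : normedModType R) (n : nat) (j : 'I_n)
    (f : cube n -> X) (eps : cube n) : X :=
  2^-1 *: (f eps - f (cube_flip j eps)).

Definition rademacher_type_bound (R : realType) (X : normedModType R)
    (p C : R) : Prop :=
  forall (n : nat) (x : 'I_n -> X), (0 < n)%N ->
    cube_mean (fun eps : cube n =>
      `|\sum_(j < n) cube_sign R eps j *: x j| `^ p)
    <= C `^ p * \sum_(j < n) `|x j| `^ p.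

Definition has_rademacher_type (R : realType) (X : normedModType R) (p : R)
    : Prop :=
  exists2 C : R, 0 < C & rademacher_type_bound X p C.

(* [inf] takes a junk value on the empty set, so this is meaningful only under
   [has_rademacher_type X p]. *)
Definition rademacher_type_const (R : realType) (X : normedModType R) (p : R)
    : R :=
  inf [set C : R | 0 < C /\ rademacher_type_bound X p C].

(* Main.v *)
Require Import Defs.
From HB Require Import structures.
From mathcomp Require Import all_boot all_order all_algebra.
From mathcomp Require Import all_classical all_reals all_analysis.
From mathcomp Require Import ring lra.

Set Implicit Arguments.
Unset Strict Implicit.
Unset Printing Implicit Defensive.

Import Order.TTheory GRing.Theory Num.Theory.
Import numFieldNormedType.Exports.

Local Open Scope ring_scope.

(** Why the theorem holds.  For a set [B] of coordinates let [E_B f] be [f]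
    with the coordinates in [B] rerandomised (averaged out), and let [A_k] be
    the average of [E_B f] over all [B] with [k] elements.  Then [A_0 = f] and
    [A_n] is the mean of [f], so [f - E f] is the sum of the increments
    [A_k - A_(k+1)].  For [j] in [B], the difference between [E_(B - j) f] and
    [E_B f] at [eta] is the mean over signs [r] of [r_j D_j f], taken at the
    point [eta] with its coordinates in [B] multiplied by the signs [r]
    ([resample_mean_rem]).  Double counting the pairs [j \in B] turns this into
    an exact formula ([level_mean_increment]):

      [A_k - A_(k+1)] is [1 / (k + 1)] times the average, over the sets [B]
      with [k + 1] elements and over [r], of the Rademacher sum
      [\sum_(j in B) r_j D_j f] at the rerandomised point.

    The essential gain is that a whole Rademacher sum appears, to which the
    type inequality applies with its own constant.  By Jensen's inequality and
    the invariance of the uniform measure under multiplication by the signs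
    [r], type [p] with constant [C] may be used at each fixed point; since a
    given [j] belongs to the proportion [(k + 1) / n] of the sets [B], the
    increment has [L^p] norm at most

      [(k + 1)^-1 * C * ((k + 1) / n * \sum_j |D_j f|_p^p)^(1/p)].

    Finally [(k + 1)^(1/p - 1) <= p ((k + 1)^(1/p) - k^(1/p))] because [x^p]
    lies above its tangents ([powR_inv_le_increment]); the right-hand sides
    telescope to [p * n^(1/p)], and Minkowski's inequality gives the bound
    with [p * C].  Taking the infimum over [C] ends the proof.

    This is a discrete counterpart of integrating the derivative of the noise
    semigroup on the cube, in which the coordinates are rerandomised one after
    the other in a uniformly random order. *)

(** * Convexity of powers *)

Section PowerInequalities.
Variable R : realType.
Implicit Types (p a b : R).

(** For [p > 1] this is Young's inequality for [a * b `^ (p - 1)], with the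
    exponents [p] and [p / (p - 1)]. *)
Lemma powR_tangent p a b : 1 <= p -> 0 <= a -> 0 <= b ->
  b `^ p + p * b `^ (p - 1) * (a - b) <= a `^ p.
Proof.
move=> p1 a0 b0; have p0 : 0 < p by lra.
have [->|pn1] := eqVneq p 1.
  by rewrite subrr powRr0 !powRr1// !mul1r addrC subrK.
have pm0 : 0 < p - 1 by rewrite subr_gt0 lt_neqAle eq_sym pn1.
have := @conjugate_powR R a (b `^ (p - 1)) p (p / (p - 1)) a0 (powR_ge0 _ _) p0
  (divr_gt0 p0 pm0).
rewrite -powRrM mulrCA divff ?gt_eqF// mulr1 => /(_ _)/wrap[].
  by field; rewrite !gt_eqF.
rewrite -(ler_pM2l p0) => h.
have hb := mulr_powRB1 b0 p0.
have -> : p * b `^ (p - 1) * (a - b) = p * (a * b `^ (p - 1)) - p * b `^ p.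
  by rewrite -hb; ring.
suff e : p * (a `^ p / p + b `^ p / (p / (p - 1))) = a `^ p + (p - 1) * b `^ p.
  by rewrite e in h; lra.
by field; rewrite !gt_eqF.
Qed.

(** The left-hand side is [a `^ (p^-1 - 1)], so that up to the factor [p] this
    compares a derivative of the concave function [x `^ p^-1] with an
    increment.  It is the tangent inequality for [x `^ p], taken at the
    [p]-th roots of [a] and [a - 1]. *)
Lemma powR_inv_le_increment p a : 1 <= p -> 1 <= a ->
  a `^ p^-1 / a <= p * (a `^ p^-1 - (a - 1) `^ p^-1).
Proof.
move=> p1 a1; have p0 : 0 < p by lra.
have a0 : 0 < a by lra.
have b0 : 0 <= a - 1 by lra.
have rootK c : 0 <= c -> (c `^ p^-1) `^ p = c.
  by move=> c0; rewrite -powRrM mulVf ?gt_eqF// powRr1.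
have t0 : 0 < a `^ p^-1 by exact: powR_gt0.
have := powR_tangent p1 (powR_ge0 (a - 1) p^-1) (ltW t0).
rewrite -[(a `^ _) `^ (p - 1)](mulKf (lt0r_neq0 t0)).
rewrite (mulr_powRB1 (ltW t0) p0) (rootK _ b0) (rootK _ (ltW a0)) => h.
have t1 : 0 < a / a `^ p^-1 by rewrite divr_gt0.
rewrite -(ler_pM2l t1).
have -> : a / a `^ p^-1 * (a `^ p^-1 / a) = 1 by field; rewrite !gt_eqF.
rewrite mulrC in h; lra.
Qed.

(** Average the tangent inequality at the mean [m] of the [t i]: the linear
    terms cancel. *)
Lemma jensen_powR (I : Type) (r : seq I) (P : pred I) (w t : I -> R) p :
  1 <= p -> (forall i, P i -> 0 <= w i) -> (forall i, P i -> 0 <= t i) ->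
  \sum_(i <- r | P i) w i = 1 ->
  (\sum_(i <- r | P i) w i * t i) `^ p <= \sum_(i <- r | P i) w i * t i `^ p.
Proof.
move=> p1 w0 t0 w1; set m := \sum_(i <- r | P i) w i * t i.
have m0 : 0 <= m by apply: sumr_ge0 => i Pi; rewrite mulr_ge0 ?w0 ?t0.
have : \sum_(i <- r | P i) w i * (m `^ p + p * m `^ (p - 1) * (t i - m))
       <= \sum_(i <- r | P i) w i * t i `^ p.
  by apply: ler_sum => i Pi; rewrite ler_wpM2l ?w0// powR_tangent ?t0.
congr (_ <= _); rewrite (eq_bigr (fun i => w i * (m `^ p - p * m `^ (p - 1) * m)
   + p * m `^ (p - 1) * (w i * t i))); last by move=> i _; ring.
by rewrite big_split/= -mulr_suml -mulr_sumr w1 -/m; ring.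
Qed.

Lemma jensen_powR_norm (X : normedModType R) (I : Type) (r : seq I) (P : pred I)
    (w : I -> R) (x : I -> X) p :
  1 <= p -> (forall i, P i -> 0 <= w i) -> \sum_(i <- r | P i) w i = 1 ->
  `|\sum_(i <- r | P i) w i *: x i| `^ p
  <= \sum_(i <- r | P i) w i * `|x i| `^ p.
Proof.
move=> p1 w0 w1; apply: le_trans (jensen_powR p1 w0 _ w1) => //.
apply: ge0_ler_powR; rewrite ?nnegrE//; first lra.
  by apply: sumr_ge0 => i Pi; rewrite mulr_ge0 ?w0.
apply: le_trans (ler_norm_sum _ _ _) _.
by apply: ler_sum => i Pi; rewrite normrZ ger0_norm ?w0.
Qed.

End PowerInequalities.

(** * Means and norms on the cube *)

Section CubeNorms.
Variables (R : realType) (n : nat).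
Implicit Types (X : normedModType R) (p : R) (g : cube n -> R).

Lemma card_cube : #|{: cube n}| = (2 ^ n)%N.
Proof. by rewrite card_ffun card_bool card_ord. Qed.

Lemma cube_meanE g : cube_mean g = (2 ^+ n)^-1 * \sum_eps g eps.
Proof. by []. Qed.

Lemma cube_mean_ge0 g : (forall eps, 0 <= g eps) -> 0 <= cube_mean g.
Proof.
move=> g0; rewrite cube_meanE mulr_ge0 ?invr_ge0 ?exprn_ge0//.
exact: sumr_ge0.
Qed.

Lemma ler_cube_mean g1 g2 : (forall eps, g1 eps <= g2 eps) ->
  cube_mean g1 <= cube_mean g2.
Proof.
move=> g12; rewrite !cube_meanE ler_wpM2l ?invr_ge0 ?exprn_ge0//.
exact: ler_sum.
Qed.

Lemma cube_mean_sum X (I : Type) (r : seq I) (P : pred I)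
    (g : I -> cube n -> X) :
  cube_mean (fun eps => \sum_(i <- r | P i) g i eps)
  = \sum_(i <- r | P i) cube_mean (g i).
Proof. by rewrite /cube_mean exchange_big scaler_sumr. Qed.

Lemma cube_meanZl a g : cube_mean (fun eps => a * g eps) = a * cube_mean g.
Proof. by rewrite !cube_meanE -mulr_sumr mulrCA. Qed.

Lemma exchange_cube_mean (h : cube n -> cube n -> R) :
  cube_mean (fun eps => cube_mean (h eps))
  = cube_mean (fun r => cube_mean (h^~ r)).
Proof.
by rewrite !cube_meanE -!mulr_sumr exchange_big.
Qed.

Lemma reindex_cube_mean X (s : cube n -> cube n) (g : cube n -> X) :
  involutive s -> cube_mean (g \o s) = cube_mean g.
Proof.
by move=> sK; rewrite /cube_mean [in RHS](reindex_inj (inv_inj sK)).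
Qed.

Lemma cube_mean_const X (x : X) : cube_mean (fun _ : cube n => x) = x.
Proof.
by rewrite /cube_mean sumr_const card_cube -[x *+ _]scaler_nat scalerA natrX
  mulVf ?scale1r// expf_neq0.
Qed.

Lemma jensen_cube_mean X p (g : cube n -> X) : 1 <= p ->
  `|cube_mean g| `^ p <= cube_mean (fun eps => `|g eps| `^ p).
Proof.
move=> p1; rewrite cube_meanE /cube_mean scaler_sumr mulr_sumr.
apply: jensen_powR_norm => //.
by rewrite -[RHS](cube_mean_const (1 : R^o)) cube_meanE mulr_sumr;
  apply: eq_bigr => i _; rewrite mulr1.
Qed.

Lemma cube_Lp_powR X p (g : cube n -> X) : 0 < p ->
  cube_Lp p g `^ p = cube_mean (fun eps => `|g eps| `^ p).
Proof.
move=> p0; rewrite /cube_Lp -powRrM mulVf ?gt_eqF// powRr1//.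
by apply: cube_mean_ge0 => eps; exact: powR_ge0.
Qed.

Lemma cube_Lp_le X p (g : cube n -> X) (c : R) : 0 < p -> 0 <= c ->
  cube_mean (fun eps => `|g eps| `^ p) <= c `^ p -> cube_Lp p g <= c.
Proof.
move=> p0 c0; rewrite -cube_Lp_powR// => h.
have rootK x : 0 <= x -> (x `^ p) `^ p^-1 = x.
  by move=> x0; rewrite -powRrM mulfV ?gt_eqF// powRr1.
rewrite -(rootK _ c0) -[leLHS](rootK _ (powR_ge0 _ _)).
have pV0 : 0 <= p^-1 by rewrite invr_ge0 ltW.
by apply: (ge0_ler_powR pV0) => //; rewrite nnegrE powR_ge0.
Qed.

(** Minkowski's inequality.  With [c i] slightly larger than the norm of [F i]
    and [s] their sum, [\sum_i F i] is [s] times the convex combination, with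
    weights [c i / s], of the functions [F i / c i] of norm at most 1; Jensen's
    inequality shows that such a combination has norm at most 1. *)
Lemma cube_Lp_sum X p (I : finType) (F : I -> cube n -> X) : 1 <= p ->
  cube_Lp p (fun eps => \sum_i F i eps) <= \sum_i cube_Lp p (F i).
Proof.
move=> p1; have p0 : 0 < p by lra.
apply/ler_addgt0Pr => e e0.
(* The margin [d] keeps every [c i] positive, even where [F i] has norm 0. *)
pose d := e / (#|I|.+1)%:R.
have d0 : 0 < d by rewrite divr_gt0.
pose c i := cube_Lp p (F i) + d.
have c0 i : 0 < c i by rewrite /c ltr_wpDl ?powR_ge0.
have sumc : \sum_i c i <= \sum_i cube_Lp p (F i) + e.
  rewrite big_split/= lerD2l sumr_const -mulr_natr /d mulrAC.
  by rewrite ler_pdivrMr// ler_pM2l// ler_nat.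
apply: le_trans sumc; apply: cube_Lp_le => //.
  by apply: sumr_ge0 => i _; exact: ltW.
have [i0 _|I0] := pickP (fun _ : I => true); last first.
  rewrite big_pred0// [leLHS](_ : _ = 0) ?powR_ge0//.
  rewrite cube_meanE big1 ?mulr0// => eps _.
  by rewrite big_pred0// normr0 powR0 ?gt_eqF.
set s := \sum_i c i.
have s0 : 0 < s.
  rewrite /s (bigD1 i0)//= ltr_pwDl//; apply: sumr_ge0 => i _; exact: ltW.
apply: (@le_trans _ _ (cube_mean (fun eps =>
    s `^ p * \sum_i c i / s * ((c i)^-1 `^ p * `|F i eps| `^ p)))).
  apply: ler_cube_mean => eps.
  have -> : \sum_i F i eps = s *: \sum_i (c i / s) *: ((c i)^-1 *: F i eps).
    rewrite scaler_sumr; apply: eq_bigr => i _.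
    rewrite !scalerA [_ * _](_ : _ = 1) ?scale1r//.
    by field; rewrite !gt_eqF.
  rewrite normrZ (ger0_norm (ltW s0)) (powRM _ (ltW s0) (normr_ge0 _)).
  rewrite ler_pM2l ?powR_gt0//.
  apply: le_trans (jensen_powR_norm _ p1 _ _) _.
  - by move=> i _; rewrite divr_ge0 ?ltW.
  - by rewrite -mulr_suml divff ?gt_eqF.
  apply: ler_sum => i _; rewrite normrZ powRM//.
  by rewrite ger0_norm// invr_ge0 ltW.
rewrite cube_meanZl -[leRHS]mulr1 ler_pM2l ?powR_gt0//.
rewrite cube_mean_sum -[leRHS](divff (lt0r_neq0 s0)) -[X in X / s]/(\sum_i c i).
rewrite mulr_suml; apply: ler_sum => i _.
rewrite cube_meanZl cube_meanZl ler_piMr ?(divr_ge0 (ltW (c0 i)) (ltW s0))//.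
rewrite -cube_Lp_powR// -powRM ?invr_ge0 ?powR_ge0 ?(ltW (c0 i))//.
rewrite [leRHS](_ : 1 = 1 `^ p); last by rewrite powR1.
apply: (ge0_ler_powR (ltW p0)); rewrite ?nnegrE//.
  by rewrite mulr_ge0 ?invr_ge0 ?powR_ge0 ?ltW.
by rewrite mulrC ler_pdivrMr// mul1r /c lerDl ltW.
Qed.

End CubeNorms.

(** * Rerandomising a set of coordinates *)

Section ResamplingCoordinates.
Variables (R : realType) (X : normedModType R) (n : nat).
Implicit Types (B : {set 'I_n}) (r eta : cube n) (f : cube n -> X).

(** Multiplying by the signs [r], rather than replacing the coordinates in [B]
    by [r], makes the map an involution of the cube for each fixed [r]; the
    uniform measure is therefore preserved. *)
Definition resample B r eta : cube n :=
  [ffun i => eta i (+) ((i \in B) && r i)].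

Definition resample_mean B f eta : X :=
  cube_mean (fun r => f (resample B r eta)).

Lemma resampleK B r : involutive (resample B r).
Proof. by move=> eta; apply/ffunP => i; rewrite !ffunE addbK. Qed.

Lemma cube_flipK j : involutive (@cube_flip n j).
Proof.
by move=> eta; apply/ffunP => i; rewrite !ffunE; case: eqP => //; rewrite negbK.
Qed.

Lemma resample_flip B j r eta : j \in B ->
  resample B (cube_flip j r) eta = cube_flip j (resample B r eta).
Proof.
move=> jB; apply/ffunP => i; rewrite !ffunE.
by case: eqP => // ->; rewrite jB addbN.
Qed.

Lemma resample_rem B j r eta : j \in B ->
  resample B r eta = let zeta := resample (B :\ j) r eta in
                     if r j then cube_flip j zeta else zeta.
Proof.
move=> jB /=; apply/ffunP => i; case rj: (r j); rewrite !ffunE !inE.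
  by case: eqP => // -> /=; rewrite jB rj addbT addbF.
by case: eqP => // -> /=; rewrite rj andbF.
Qed.

Lemma resample_mean0 f eta : resample_mean finset.set0 f eta = f eta.
Proof.
rewrite /resample_mean -[RHS](@cube_mean_const R n); congr cube_mean.
apply/funext => r; congr f; apply/ffunP => i.
by rewrite ffunE inE addbF.
Qed.

Lemma resample_meanT f eta : resample_mean [set: 'I_n]%SET f eta = cube_mean f.
Proof.
rewrite /resample_mean -(reindex_cube_mean f (resampleK [set: 'I_n]%SET eta)).
congr cube_mean; apply/funext => r; congr f; apply/ffunP => i.
by rewrite !ffunE inE addbC.
Qed.

(** Put [zeta := resample (B :\ j) r eta].  The point [resample B r eta] and
    its flip at [j] are [zeta] and the flip of [zeta], in an order decided by
    [r j].  The sign [r j] undoes the order, hence [r_j D_j f] at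
    [resample B r eta] is always [D_j f zeta], that is, [f zeta] minus the
    average of [f] over these two points.  Averaged over [r], that last term
    becomes [resample_mean B f eta]. *)
Lemma resample_mean_rem B j f eta : j \in B ->
  resample_mean (B :\ j) f eta - resample_mean B f eta
  = cube_mean (fun r => cube_sign R r j *: cube_D j f (resample B r eta)).
Proof.
move=> jB.
have avg : resample_mean B f eta = cube_mean (fun r => 2^-1 *:
    (f (resample B r eta) + f (resample B (cube_flip j r) eta))).
  rewrite /cube_mean -scaler_sumr big_split/= scalerDr.
  have -> : \sum_r f (resample B (cube_flip j r) eta)
            = \sum_r f (resample B r eta).
    by rewrite [RHS](reindex_inj (inv_inj (@cube_flipK j))).
  by rewrite -scalerDl -[2^-1]mul1r -splitr scale1r.
rewrite avg {avg} /resample_mean /cube_mean -scalerBr -sumrB; congr (_ *: _).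
apply: eq_bigr => r _.
rewrite resample_flip// (resample_rem r eta jB) /= /cube_sign /cube_D.
set zeta := resample _ _ _.
have half (x : X) : x = 2^-1 *: x + 2^-1 *: x.
  by rewrite -scalerDl -[2^-1]mul1r -splitr scale1r.
rewrite [in LHS](half (f zeta)).
case: (r j); rewrite ?cube_flipK ?expr1 ?expr0 ?scaleN1r ?scale1r.
  rewrite scalerDr scalerBr opprB.
  by rewrite [_ *: f (cube_flip _ _) + _ *: f zeta]addrC addrKA.
by rewrite scalerDr scalerBr addrKA.
Qed.

End ResamplingCoordinates.

(** * Averages over the sets of a given size *)

Section SubsetAverages.
Variables (R : realType) (n : nat).
Implicit Types (X : normedModType R) (B : {set 'I_n}).

Definition subset_mean X (k : nat) (h : {set 'I_n} -> X) : X :=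
  'C(n, k)%:R^-1 *: \sum_(B : {set 'I_n} | #|B| == k) h B.

Lemma binn_neq0 k : (k <= n)%N -> 'C(n, k)%:R != 0 :> R.
Proof. by move=> kn; rewrite pnatr_eq0 -lt0n bin_gt0. Qed.

(** A set with [k] elements arises as [B :\ j] once for each of the [n - k]
    elements [j] outside it. *)
Lemma sum_subset_rem (V : zmodType) k (h : {set 'I_n} -> V) :
  \sum_(B : {set 'I_n} | #|B| == k.+1) \sum_(j in B) h (B :\ j)
  = (\sum_(B : {set 'I_n} | #|B| == k) h B) *+ (n - k).
Proof.
rewrite (exchange_big_dep predT)//=.
transitivity (\sum_j \sum_(B : {set 'I_n} | (#|B| == k) && (j \notin B)) h B).
  apply: eq_bigr => j _.
  rewrite (reindex_onto (fun B => j |: B) (fun B => B :\ j))/=; last first.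
    by move=> B /andP[_ jB]; rewrite finset.setD1K.
  apply: eq_big => [B|B /andP[_ /eqP->]//].
  rewrite setU11 andbT; case jB: (j \in B).
    rewrite andbF; apply/negP => /andP[_ /eqP e].
    by move: jB; rewrite -e !inE eqxx.
  by rewrite cardsU1 jB add1n eqSS finset.setU1K ?jB// eqxx.
rewrite (exchange_big_dep (fun B => #|B| == k))/=; last by move=> j B _ /andP[].
rewrite -sumrMnl; apply: eq_bigr => B /eqP Bk.
rewrite (eq_bigl (fun j => j \in ~: B)); last first.
  by move=> j; rewrite Bk eqxx inE.
rewrite sumr_const; congr (_ *+ _).
by have /(congr1 (subn^~ k)) := finset.cardsC B; rewrite Bk card_ord addKn.
Qed.

Lemma subset_mean_rem X k (h : {set 'I_n} -> X) : (k < n)%N ->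
  subset_mean k.+1 (fun B => \sum_(j in B) h (B :\ j))
  = k.+1%:R *: subset_mean k h.
Proof.
move=> kn.
rewrite /subset_mean sum_subset_rem -[_ *+ (n - k)]scaler_nat !scalerA.
congr (_ *: _); have := congr1 (fun m : nat => m%:R : R) (mul_bin_left n k).
rewrite !natrM => e.
have b1 := binn_neq0 kn; have b0 := binn_neq0 (ltnW kn).
have -> : (n - k)%:R = k.+1%:R * 'C(n, k.+1)%:R / 'C(n, k)%:R :> R.
  by rewrite e mulfK.
by rewrite mulrC mulrAC mulfK.
Qed.

Lemma subset_mean_sum_const X k (h : {set 'I_n} -> X) : (k <= n)%N ->
  subset_mean k (fun B => \sum_(j in B) h B) = k%:R *: subset_mean k h.
Proof.
move=> kn; rewrite /subset_mean scalerA mulrC -scalerA; congr (_ *: _).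
by rewrite scaler_sumr; apply: eq_bigr => B /eqP Bk;
  rewrite sumr_const Bk scaler_nat.
Qed.

(** Each [j] lies in ['C(n.-1, k)] of the sets with [k.+1] elements, by Pascal's
    rule from the count of the sets that avoid [j]. *)
Lemma subset_mean_sum k (a : 'I_n -> R) : (k < n)%N ->
  subset_mean k.+1 (fun B => \sum_(j in B) a j) = k.+1%:R / n%:R * \sum_j a j.
Proof.
move=> kn; have n0 : (0 < n)%N by exact: leq_ltn_trans kn.
rewrite /subset_mean (exchange_big_dep predT)//=.
have card_mem (j : 'I_n) :
    #|[pred B : {set 'I_n} | (#|B| == k.+1) && (j \in B)]| = 'C(n.-1, k).
  have sub : 'C(n, k.+1) = ('C(n.-1, k.+1) + 'C(n.-1, k))%N.
    by rewrite -{1}(prednK n0) binS.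
  apply/eqP; rewrite -(eqn_add2l 'C(n.-1, k.+1)) -sub; apply/eqP.
  have -> : 'C(n.-1, k.+1) =
      #|[set B : {set 'I_n} | B \subset [set~ j] & #|B| == k.+1]%SET|.
    by rewrite cards_draws cardsC1 card_ord.
  have -> : 'C(n, k.+1) = #|[set B : {set 'I_n} | #|B| == k.+1]%SET|.
    by rewrite card_draws card_ord.
  rewrite -(cardsID [set B : {set 'I_n} | B \subset [set~ j]]%SET
    [set B : {set 'I_n} | #|B| == k.+1]%SET).
  have subC1 B : (B \subset [set~ j]%SET) = (j \notin B).
    by rewrite -finset.disjoints_subset disjoint_sym disjoints1.
  congr addn; apply: eq_card => B; rewrite !inE subC1 1?andbC//.
  by rewrite negbK andbC.
rewrite (eq_bigr (fun j => 'C(n.-1, k)%:R * a j)); last first.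
  by move=> j _; rewrite sumr_const card_mem mulr_natl.
rewrite -mulr_sumr /GRing.scale/= mulrA; congr (_ * _).
have := congr1 (fun m : nat => m%:R : R) (mul_bin_diag n k).
rewrite !natrM => e.
have b1 := binn_neq0 kn; have nn0 : n%:R != 0 :> R by rewrite pnatr_eq0 -lt0n.
have -> : 'C(n.-1, k)%:R = k.+1%:R / n%:R * 'C(n, k.+1)%:R :> R.
  by rewrite mulrAC -e mulrC mulKf.
by rewrite mulrC mulfK.
Qed.

Lemma ler_subset_mean k (h1 h2 : {set 'I_n} -> R) :
  (forall B, #|B| = k -> h1 B <= h2 B) -> subset_mean k h1 <= subset_mean k h2.
Proof.
move=> h12; rewrite /subset_mean ler_wpM2l ?invr_ge0//.
by apply: ler_sum => B /eqP; exact: h12.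
Qed.

Lemma jensen_subset_mean X p k (h : {set 'I_n} -> X) : 1 <= p -> (k <= n)%N ->
  `|subset_mean k h| `^ p <= subset_mean k (fun B => `|h B| `^ p).
Proof.
move=> p1 kn; rewrite /subset_mean scaler_sumr [leRHS]mulr_sumr.
apply: jensen_powR_norm => //.
have card_k : #|[pred B : {set 'I_n} | #|B| == k]| = 'C(n, k).
  transitivity #|[set B : {set 'I_n} | #|B| == k]%SET|.
    by apply: eq_card => B; rewrite !inE.
  by rewrite card_draws card_ord.
by rewrite sumr_const card_k -(mulr_natr _^-1) mulVf// binn_neq0.
Qed.

End SubsetAverages.

(** * The increments of the level averages *)

Section Increments.
Variables (R : realType) (X : normedModType R) (n : nat).
Implicit Types (f : cube n -> X) (p C : R).

Definition level_mean k f (eta : cube n) : X :=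
  subset_mean k (fun B => resample_mean B f eta).

Lemma level_mean0 f eta : level_mean 0 f eta = f eta.
Proof.
rewrite /level_mean /subset_mean bin0 invr1 scale1r.
rewrite (big_pred1 finset.set0) ?resample_mean0// => B.
by rewrite finset.cards_eq0.
Qed.

Lemma level_mean_max f eta : level_mean n f eta = cube_mean f.
Proof.
rewrite /level_mean /subset_mean binn invr1 scale1r.
rewrite (big_pred1 [set: 'I_n]%SET) ?resample_meanT// => B.
by rewrite /= finset.eqEcard finset.subsetT cardsT card_ord/= eqn_leq
  -[X in (_ <= X)%N && _](card_ord n) max_card.
Qed.

(** Sum [resample_mean_rem] over [j] in [B] and average over [B]: removing an
    element from a uniform set of size [k.+1] leaves a uniform set of size [k],
    so both terms are [k.+1] times a level average. *)
Lemma level_mean_increment k f eta : (k < n)%N ->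
  level_mean k f eta - level_mean k.+1 f eta
  = k.+1%:R^-1 *: subset_mean k.+1 (fun B => cube_mean (fun r =>
      \sum_(j in B) cube_sign R r j *: cube_D j f (resample B r eta))).
Proof.
move=> kn; have k0 : k.+1%:R != 0 :> R by rewrite pnatr_eq0.
have -> : subset_mean k.+1 (fun B => cube_mean (fun r =>
      \sum_(j in B) cube_sign R r j *: cube_D j f (resample B r eta)))
  = subset_mean k.+1 (fun B => \sum_(j in B) resample_mean (B :\ j)%SET f eta)
  - subset_mean k.+1 (fun B => \sum_(j in B) resample_mean B f eta).
  rewrite /subset_mean -scalerBr -sumrB; congr (_ *: _).
  apply: eq_bigr => B _; rewrite cube_mean_sum -sumrB.
  by apply: eq_bigr => j jB; rewrite resample_mean_rem.
rewrite (subset_mean_rem (fun B => resample_mean B f eta))//.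
by rewrite subset_mean_sum_const// -scalerBr scalerK.
Qed.

(** The type inequality for the vectors [x j], [j \in B], extended by zero. *)
Lemma rademacher_type_bound_subset p C (x : 'I_n -> X) (B : {set 'I_n}) :
  0 < p -> (0 < n)%N -> rademacher_type_bound X p C ->
  cube_mean (fun r : cube n => `|\sum_(j in B) cube_sign R r j *: x j| `^ p)
  <= C `^ p * \sum_(j in B) `|x j| `^ p.
Proof.
move=> p0 n0 /(_ n (fun j => if j \in B then x j else 0) n0).
congr (_ <= _ * _).
  congr cube_mean; apply/funext => r; congr (`|_| `^ p).
  by rewrite [RHS]big_mkcond/=; apply: eq_bigr => j _;
    case: ifP => // _; rewrite scaler0.
rewrite [RHS]big_mkcond/=; apply: eq_bigr => j _; case: ifP => // _.
by rewrite normr0 powR0 ?gt_eqF.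
Qed.

(** For fixed signs [r] the point [resample B r eta] is uniform when [eta] is.
    After this change of variables the differences [D_j f] no longer depend on
    [r], and the type inequality applies with them as coefficients. *)
Lemma level_mean_increment_powR k f p C : 1 <= p -> (k < n)%N ->
  rademacher_type_bound X p C ->
  cube_mean (fun eta => `|level_mean k f eta - level_mean k.+1 f eta| `^ p)
  <= k.+1%:R^-1 `^ p * (k.+1%:R / n%:R
     * (C `^ p * \sum_(j < n) cube_Lp p (cube_D j f) `^ p)).
Proof.
move=> p1 kn hC; have p0 : 0 < p by lra.
have n0 : (0 < n)%N by exact: leq_ltn_trans kn.
pose S (B : {set 'I_n}) r eta :=
  \sum_(j in B) cube_sign R r j *: cube_D j f (resample B r eta).
pose T (B : {set 'I_n}) (r zeta : cube n) :=
  \sum_(j in B) cube_sign R r j *: cube_D j f zeta.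
have pointwise eta : `|level_mean k f eta - level_mean k.+1 f eta| `^ p
    <= k.+1%:R^-1 `^ p
       * subset_mean k.+1 (fun B => cube_mean (fun r => `|S B r eta| `^ p)).
  rewrite level_mean_increment// normrZ powRM// ger0_norm//.
  rewrite ler_pM2l ?powR_gt0//.
  apply: le_trans (jensen_subset_mean _ p1 kn) _.
  by apply: ler_subset_mean => B _; exact: jensen_cube_mean.
apply: le_trans (ler_cube_mean pointwise) _.
rewrite cube_meanZl ler_pM2l ?powR_gt0//.
rewrite [leLHS](_ : _ = subset_mean k.+1 (fun B =>
    cube_mean (fun eta => cube_mean (fun r => `|S B r eta| `^ p)))); last first.
  by rewrite cube_meanZl cube_mean_sum.
have type_B (B : {set 'I_n}) :
    cube_mean (fun eta => cube_mean (fun r => `|S B r eta| `^ p))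
    <= \sum_(j in B) C `^ p * cube_Lp p (cube_D j f) `^ p.
  rewrite exchange_cube_mean.
  have -> : (fun r => cube_mean (fun eta => `|S B r eta| `^ p))
          = (fun r => cube_mean (fun zeta => `|T B r zeta| `^ p)).
    apply/funext => r.
    exact: (reindex_cube_mean (fun zeta => `|T B r zeta| `^ p : R^o)
      (resampleK B r)).
  rewrite exchange_cube_mean.
  apply: (@le_trans _ _ (cube_mean (fun zeta =>
      C `^ p * \sum_(j in B) `|cube_D j f zeta| `^ p))).
    by apply: ler_cube_mean => zeta; exact: rademacher_type_bound_subset.
  rewrite cube_meanZl -mulr_sumr cube_mean_sum; apply: ler_wpM2l.
    exact: powR_ge0.
  by apply: ler_sum => j _; rewrite cube_Lp_powR.
apply: le_trans (ler_subset_mean (fun B _ => type_B B)) _.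
by rewrite (subset_mean_sum (fun j => C `^ p * cube_Lp p (cube_D j f) `^ p))//
  -mulr_sumr.
Qed.

(** The [p]-th root of the preceding bound, with [k.+1 `^ (p^-1 - 1)] replaced
    by an increment of [x `^ p^-1] so that the bounds telescope in [k]. *)
Lemma cube_Lp_level_mean_increment k f p C : 1 <= p -> 0 < C -> (k < n)%N ->
  rademacher_type_bound X p C ->
  cube_Lp p (fun eta => level_mean k f eta - level_mean k.+1 f eta)
  <= p * (k.+1%:R `^ p^-1 - k%:R `^ p^-1) / n%:R `^ p^-1
     * (C * (\sum_(j < n) cube_Lp p (cube_D j f) `^ p) `^ p^-1).
Proof.
move=> p1 C0 kn hC; have p0 : 0 < p by lra.
have n0 : 0 < n%:R :> R by rewrite ltr0n; exact: leq_ltn_trans kn.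
set V := \sum_(j < n) _.
have V0 : 0 <= V by apply: sumr_ge0 => j _; exact: powR_ge0.
have rootK (x : R) : 0 <= x -> (x `^ p^-1) `^ p = x.
  by move=> x0; rewrite -powRrM mulVf ?gt_eqF// powRr1.
have nr0 : 0 < n%:R `^ p^-1 :> R by exact: powR_gt0.
apply: (@le_trans _ _ (k.+1%:R `^ p^-1 / k.+1%:R / n%:R `^ p^-1
                       * (C * V `^ p^-1))); last first.
  apply: ler_wpM2r; first by rewrite mulr_ge0 ?powR_ge0// ltW.
  rewrite ler_pM2r ?invr_gt0//; rewrite -[X in _ - X `^ _](addrK 1) natr1.
  by apply: powR_inv_le_increment => //; rewrite ler1n.
apply: cube_Lp_le => //.
  by rewrite !mulr_ge0 ?invr_ge0 ?powR_ge0// ltW.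
apply: le_trans (level_mean_increment_powR f p1 kn hC) _.
rewrite !powRM ?mulr_ge0 ?invr_ge0 ?powR_ge0 ?(ltW C0)//.
have inv_powR (x : R) : 0 <= x -> x^-1 `^ p = (x `^ p)^-1.
  by move=> x0; rewrite -powR_inv1// -powRrM mulrC powRrM powR_inv1 ?powR_ge0.
rewrite [(n%:R `^ _)^-1 `^ p]inv_powR ?powR_ge0// !rootK ?(ltW n0)//.
by rewrite -/V le_eqVlt; apply/orP; left; apply/eqP; ring.
Qed.

Lemma cube_Lp_centered_le f p C : 1 <= p -> 0 < C -> (0 < n)%N ->
  rademacher_type_bound X p C ->
  cube_Lp p (fun eta => f eta - cube_mean f)
  <= p * C * (\sum_(j < n) cube_Lp p (cube_D j f) `^ p) `^ p^-1.
Proof.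
move=> p1 C0 n0 hC; have p0 : 0 < p by lra.
have -> : (fun eta => f eta - cube_mean f) = (fun eta =>
    \sum_(k < n) (level_mean k f eta - level_mean k.+1 f eta)).
  apply/funext => eta.
  rewrite -(level_mean_max f eta) -[in LHS](level_mean0 f eta).
  rewrite -opprB -(telescope_sumr (fun k => level_mean k f eta) (leq0n n)).
  rewrite big_mkord -sumrN.
  by apply: eq_bigr => k _; rewrite opprB.
apply: le_trans (cube_Lp_sum _ p1) _.
apply: le_trans (ler_sum _ (fun k _ =>
  cube_Lp_level_mean_increment f p1 C0 (ltn_ord k) hC)) _.
rewrite -mulr_suml -mulr_suml -mulr_sumr.
rewrite -(big_mkord predT (fun k => k.+1%:R `^ p^-1 - k%:R `^ p^-1 : R)).
rewrite (telescope_sumr (fun k => k%:R `^ p^-1 : R) (leq0n n)).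
rewrite powR0 ?invr_eq0 ?gt_eqF// subr0 mulfK ?mulrA//.
by rewrite gt_eqF// powR_gt0// ltr0n.
Qed.

End Increments.

Theorem theorem1p1 (R : realType) (X : completeNormedModType R) (p : R)
    (hp1 : 1 <= p) (hp2 : p <= 2) (hX : has_rademacher_type X p)
    (n : nat) (hn : (0 < n)%N) (f : cube n -> X) :
  cube_Lp p (fun eps => f eps - cube_mean f)
  <= p * rademacher_type_const X p
     * (\sum_(j < n) cube_Lp p (cube_D j f) `^ p) `^ p^-1.
Proof.
have p0 : 0 < p by lra.
set S := _ `^ p^-1; have S0 : 0 <= S by exact: powR_ge0.
have bound C : 0 < C -> rademacher_type_bound X p C ->
    cube_Lp p (fun eps => f eps - cube_mean f) <= p * C * S.
  by move=> C0 hC; exact: cube_Lp_centered_le.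
case: hX => C0 C0pos C0type.
(* When [S = 0] any admissible constant suffices; otherwise one divides by
   [p * S] to reach the infimum. *)
have [S00|Spos] : S = 0 \/ 0 < S.
- by move: S0; rewrite le_eqVlt => /orP[/eqP->|]; [left|right].
- by have := bound C0 C0pos C0type; rewrite S00 !mulr0.
have pS : 0 < p * S by exact: mulr_gt0.
rewrite mulrAC mulrC -ler_pdivrMr//; apply: lb_le_inf; first by exists C0.
move=> C [Cpos Ctype]; rewrite ler_pdivrMr// mulrC mulrAC.
exact: bound.
Qed.
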